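(* Let $K$ be a compact Hausdorff space that is a Gruenhage space. Then the closed unit ball $B_{\mathscr{C}(K)^*}$ of $\mathscr{C}(K)^*$, with the $w^*$-topology, is a Gruenhage compact space.
   Context: A topological space $X$ is a Gruenhage space if there exist families $(\mathscr{U}_n)_{n\in\mathbb{N}}$ of open subsets of $X$ such that for any distinct $x,y\in X$ there exist $n\in\mathbb{N}$ and $U\in\mathscr{U}_n$ with: (i) $U\cap\{x,y\}$ is a singleton; (ii) either $x$ lies in only finitely many $U'\in\mathscr{U}_n$ or $y$ lies in only finitely many $U'\in\mathscr{U}_n$. A Gruenhage compact is a compact Hausdorff Gruenhage space. $\mathscr{C}(K)$ is the real Banach space of continuous real-valued functions on $K$ with the supremum norm, and $\mathscr{C}(K)^*$ is its dual, identified with the regular signed Borel measures on $K$ with the total variation norm. *)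

(* Defs.v *)
From HB Require Import structures.
From mathcomp Require Import all_boot all_order all_algebra.
From mathcomp Require Import all_classical all_reals all_analysis.

Set Implicit Arguments.
Unset Strict Implicit.
Unset Printing Implicit Defensive.

Import Order.TTheory GRing.Theory Num.Theory.
Import numFieldNormedType.Exports.

Local Open Scope classical_set_scope.
Local Open Scope ring_scope.

Definition gruenhage_space (X : topologicalType) : Prop :=
  exists U_ : nat -> set (set X),
    (forall n U, U_ n U -> open U) /\
    forall x y : X, x <> y -> exists n U,
      [/\ U_ n U,
          exists z, U `&` [set x; y] = [set z] &
          finite_set [set U' | U_ n U' /\ U' x] \/
          finite_set [set U' | U_ n U' /\ U' y]].

Definition gruenhage_compact (X : topologicalType) : Prop :=
  [/\ compact [set: X], hausdorff_space X & gruenhage_space X].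

(* The compactness proof is a parameter of the type because it is needed to
   make the supremum a norm. *)
Definition ctsfun (R : realType) (K : topologicalType)
  (cK : compact [set: K]) : Type := continuousType K R.

Section ctsfun_normedModType.
Variables (R : realType) (K : topologicalType) (cK : compact [set: K]).
Local Notation CK := (ctsfun R cK).

HB.instance Definition _ := Choice.copy CK (continuousType K R).

Lemma ctsfunP (f g : CK) : f =1 g -> f = g.
Proof. by move=> fg; apply/continuousEP. Qed.

Lemma ctsfun_continuous (f : CK) : continuous (f : K -> R).
Proof. exact: (@cts_fun K R f). Qed.

Let add_cts (f g : CK) : continuous (fun x => f x + g x).
Proof. by move=> x; apply: cvgD; exact: ctsfun_continuous. Qed.

Let opp_cts (f : CK) : continuous (fun x => - f x).
Proof. by move=> x; apply: cvgN; exact: ctsfun_continuous. Qed.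

Let scale_cts (a : R) (f : CK) : continuous (fun x => a * f x).
Proof. by move=> x; apply: cvgMl_tmp; exact: ctsfun_continuous. Qed.

Definition ctsfun_zero : CK := cst 0 : continuousType K R.
Definition ctsfun_add (f g : CK) : CK :=
  mkcts (@add_cts f g) : continuousType K R.
Definition ctsfun_opp (f : CK) : CK :=
  mkcts (@opp_cts f) : continuousType K R.
Definition ctsfun_scale (a : R) (f : CK) : CK :=
  mkcts (@scale_cts a f) : continuousType K R.

Let addA : associative ctsfun_add.
Proof. by move=> f g h; apply: ctsfunP => x; exact: addrA. Qed.

Let addC : commutative ctsfun_add.
Proof. by move=> f g; apply: ctsfunP => x; exact: addrC. Qed.

Let add0 : left_id ctsfun_zero ctsfun_add.
Proof. by move=> f; apply: ctsfunP => x; exact: add0r. Qed.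

Let addN : left_inverse ctsfun_zero ctsfun_opp ctsfun_add.
Proof. by move=> f; apply: ctsfunP => x; exact: addNr. Qed.

HB.instance Definition _ := GRing.isZmodule.Build CK addA addC add0 addN.

Let scaleA a b f : ctsfun_scale a (ctsfun_scale b f) = ctsfun_scale (a * b) f.
Proof. by apply: ctsfunP => x; exact: mulrA. Qed.

Let scale1 : left_id 1 ctsfun_scale.
Proof. by move=> f; apply: ctsfunP => x; exact: mul1r. Qed.

Let scaleDr : right_distributive ctsfun_scale +%R.
Proof. by move=> a f g; apply: ctsfunP => x; exact: mulrDr. Qed.

Let scaleDl f : {morph ctsfun_scale^~ f : a b / a + b}.
Proof. by move=> a b; apply: ctsfunP => x; exact: mulrDl. Qed.

HB.instance Definition _ :=
  GRing.Zmodule_isLmodule.Build R CK scaleA scale1 scaleDr scaleDl.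

Definition sup_norm (f : CK) : R := sup [set `|f x| | x in [set: K]].

Lemma ctsfun_le_norm (f : CK) (x : K) : `|f x| <= sup_norm f.
Proof.
apply: sup_upper_bound; last by exists x.
apply: compact_has_sup; first by exists `|f x|, x.
apply: continuous_compact => //; apply: continuous_subspaceT => y.
by apply: cvg_norm; exact: ctsfun_continuous.
Qed.

Lemma sup_norm_le (f : CK) (M : R) :
  0 <= M -> (forall x, `|f x| <= M) -> sup_norm f <= M.
Proof.
move=> M0 fM; rewrite /sup_norm.
have [->|/set0P E0] := eqVneq [set `|f x| | x in [set: K]] set0.
  by rewrite sup0.
by apply: ge_sup => // _ [x _ <-].
Qed.

Lemma sup_norm_ge0 (f : CK) : 0 <= sup_norm f.
Proof.
have [E0|/set0P [_ [x _ _]]] := eqVneq [set `|f x| | x in [set: K]] set0.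
  by rewrite /sup_norm E0 sup0.
exact: le_trans (ctsfun_le_norm f x).
Qed.

Let sup_normD f g : sup_norm (f + g) <= sup_norm f + sup_norm g.
Proof.
apply: sup_norm_le => [|x]; first by rewrite addr_ge0 ?sup_norm_ge0.
by apply: le_trans (ler_normD (f x) (g x)) _; rewrite lerD ?ctsfun_le_norm.
Qed.

Let sup_norm_scale_le a f : sup_norm (a *: f) <= `|a| * sup_norm f.
Proof.
apply: sup_norm_le => [|x]; first by rewrite mulr_ge0 ?sup_norm_ge0.
have -> : (a *: f) x = a * f x by [].
by rewrite normrM ler_wpM2l ?ctsfun_le_norm.
Qed.

Let sup_normZ a f : sup_norm (a *: f) = `|a| * sup_norm f.
Proof.
apply/eqP; rewrite eq_le sup_norm_scale_le /=.
have [->|a0] := eqVneq a 0; first by rewrite normr0 mul0r sup_norm_ge0.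
rewrite -ler_pdivlMl ?normr_gt0// -normfV.
by rewrite -{1}(scalerK a0 f) sup_norm_scale_le.
Qed.

Let sup_norm0_eq0 f : sup_norm f = 0 -> f = 0.
Proof.
move=> f0; apply: ctsfunP => x; apply/eqP.
by rewrite -normr_le0 -f0 ctsfun_le_norm.
Qed.

HB.instance Definition _ :=
  Lmodule_isNormed.Build R CK sup_normD sup_normZ sup_norm0_eq0.

End ctsfun_normedModType.

Section dual_space.
Variables (R : realType) (V : normedModType R).

(* {ptws V -> R} carries the topology of pointwise convergence; its trace on
   the dual is the weak* topology. *)
Definition dual_space : set {ptws V -> R} :=
  [set phi | scalar (phi : V -> R) /\ continuous (phi : V -> R)].

Definition dual_norm (phi : V -> R) : R :=
  sup [set `|phi v| | v in [set v | `|v| <= 1]].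

Definition dual_ball : set {ptws V -> R} :=
  dual_space `&` [set phi | dual_norm phi <= 1].

End dual_space.

Arguments dual_ball {R} V.

(* Viewed as a type, [dual_ball V] gets the topology induced by {ptws V -> R}. *)
Definition weak_star_ball (R : realType) (V : normedModType R) :
  topologicalType := set_type (dual_ball V).

(* Main.v *)
(* Idea. For U open in K and phi in the dual ball let m(phi, U) be the supremum
   of phi f over continuous 0 <= f <= 1_U, i.e. the positive part of the measure
   of U, so that {phi | m(phi, U) > q} is weak* open. The families given by the
   Gruenhage property of K can be refined into "sunflowers": families of open
   sets any two of which meet inside a common core C, such that the cells U \ C
   separate the points of K. As m is superadditive, m(phi, C) < q forces
   m(phi, U) > q for only finitely many U in the sunflower; hence the sets
   {m(., U) > q} and {m(-., U) > q} are Gruenhage families on the dual ball,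
   provided that the numbers m(+-phi, U), with U ranging over the members and
   cores of all finite products of the sunflowers, determine phi. They do: these
   numbers determine the integral of every function of the algebra generated by
   the indicators of cells, and outside an open set of small variation all cells
   are clopen, so that, as in the Stone-Weierstrass theorem, this algebra
   approximates continuous functions uniformly there. *)
Require Import Defs.
From HB Require Import structures.
From mathcomp Require Import all_boot all_order all_algebra finmap.
From mathcomp Require Import all_classical all_reals all_analysis.
From mathcomp Require Import ring lra.

Set Implicit Arguments.
Unset Strict Implicit.
Unset Printing Implicit Defensive.

Import Order.TTheory GRing.Theory Num.Theory.
Import numFieldNormedType.Exports.

Local Open Scope classical_set_scope.
Local Open Scope ring_scope.

(** If [P A] failed, the sets [Z] for which [A] minus [Z] satisfies [P] would form a proper filter.
    A cluster point in [A] has a neighbourhood satisfying [P], whose complement is in the filter. *)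
Lemma compact_ind (T : topologicalType) (A : set T) (P : set T -> Prop) :
  compact A -> P set0 ->
  (forall B C, B `<=` C -> P C -> P B) ->
  (forall B C, P B -> P C -> P (B `|` C)) ->
  (forall x, A x -> exists2 O, nbhs x O & P O) ->
  P A.
Proof.
move=> cA P0 Psub PU Ploc; apply: contrapT => nPA.
pose F : set_system T := [set Z | P (A `\` Z)].
have FF : ProperFilter F.
  split; first by rewrite /F /= setD0.
  split=> [|B C|B C BC]; rewrite /F /=.
  - by apply: Psub P0 => x [_ /(_ I)].
  - by rewrite setDIr; exact: PU.
  - by apply: Psub => x [Ax nCx]; split => // /BC.
have FA : F A by rewrite /F /= setDv.
have [x [Ax clx]] := cA F FF FA.
have [W Wx PW] := Ploc x Ax.
have FnW : F (~` W) by apply: Psub PW => y [_ /contrapT].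
by have [y [nWy Wy]] := clx _ _ FnW Wx.
Qed.

(** * Sunflowers *)

(** Distinct members meet exactly in the core [R], so the cells, that is the members minus [R], are
    pairwise disjoint. *)
Definition sunflower (T : topologicalType) (V : set (set T)) (R : set T) :=
  [/\ forall U, V U -> open U, open R, forall U, V U -> R `<=` U &
      forall U W, V U -> V W -> U <> W -> U `&` W `<=` R].

Section layers.
Variables (X : topologicalType) (U_ : set (set X)).
Hypothesis U_open : forall U, U_ U -> open U.

Definition deep k : set X :=
  [set x | exists F : {fset set X},
     [/\ [set` F] `<=` U_, (k < #|` F|)%N & forall U, U \in F -> U x]].

(** The points lying in more than [k] members are added to every [k]-fold intersection so that they
    serve as the common core. *)
Definition layer k : set (set X) :=
  [set W | exists F : {fset set X},
     [/\ [set` F] `<=` U_, #|` F| = k &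
         W = (\bigcap_(U in [set` F]) U) `|` deep k]].

Lemma open_bigcap_fset (F : {fset set X}) :
  [set` F] `<=` U_ -> open (\bigcap_(U in [set` F]) U).
Proof.
move=> FU; rewrite bigcap_fset big_seq.
elim/big_ind: _ => [|A B|U /FU /U_open//]; [exact: openT|exact: openI].
Qed.

Lemma open_deep k : open (deep k).
Proof.
have -> : deep k = \bigcup_(F in [set F : {fset set X} |
    [set` F] `<=` U_ /\ (k < #|` F|)%N]) \bigcap_(U in [set` F]) U.
  apply/seteqP; split=> x.
    by move=> [F [FU kF Fx]]; exists F.
  by move=> [F [FU kF] Fx]; exists F; split.
by apply: bigcup_open => F [FU _]; exact: open_bigcap_fset.
Qed.

(** Intersections over distinct [k]-element sets [F] and [G] meet only in points lying in all
    members of their union, which has more than [k] elements. *)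
Lemma sunflower_layer k : sunflower (layer k) (deep k).
Proof.
split=> [_ [F [FU _ ->]]||_ [F [_ _ ->]]|].
- by apply: openU; [exact: open_bigcap_fset|exact: open_deep].
- exact: open_deep.
- by move=> x; right.
move=> _ _ [F [FU Fk ->]] [G [GU Gk ->]] FG x [[Fx|//] [Gx|//]].
exists (F `|` G)%fset; split.
- by move=> U /=; rewrite in_fsetU => /orP[/FU|/GU].
- rewrite ltnNge; apply/negP => FGk; apply: FG.
  have EF : F = (F `|` G)%fset.
    by apply/eqP; rewrite eqEfcard fsubsetUl /= Fk.
  have EG : G = (F `|` G)%fset.
    by apply/eqP; rewrite eqEfcard fsubsetUr /= Gk.
  by rewrite EF {2}EG.
- by move=> U; rewrite in_fsetU => /orP[/Fx|/Gx].
Qed.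

(** Let [F] consist of all members through [x], so that [x] lies in the cell of [F]. Suppose [y]
    does too. If [U] contains only [y], then [y] lies in one member too many; if [U] contains only
    [x], then [U] is in [F] and contains [y]. *)
Lemma layer_separates U x y : U_ U -> (exists z, U `&` [set x; y] = [set z]) ->
  x <> y -> finite_set [set U' | U_ U' /\ U' x] ->
  exists k W, layer k W /\ ~ ((W `\` deep k) x <-> (W `\` deep k) y).
Proof.
move=> UU [z Uz] xy finx.
set A := [set U' | _] in finx.
have FA : [set` fset_set A] = A by rewrite fset_setK.
pose F := fset_set A.
have FU : [set` F] `<=` U_ by rewrite FA => ? [].
exists #|` F|, ((\bigcap_(U in [set` F]) U) `|` deep #|` F|); split.
  by exists F; split.
move=> [xyP yxP].
have nx : ~ deep #|` F| x.
  move=> [G [GU FG Gx]]; move: FG; rewrite ltnNge => /negP; apply.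
  apply: fsubset_leq_card; apply/fsubsetP => W WG.
  by rewrite in_fset_set// inE; split; [exact: GU|exact: Gx].
have [| [Fy|//] ny] := xyP.
  by split => //; left; rewrite FA => W [].
have Uy : ~ U y.
  move=> Uy; have Ux : ~ U x.
    move=> Ux; apply: xy.
    have : [set z] x by rewrite -Uz; split => //; left.
    have : [set z] y by rewrite -Uz; split => //; right.
    by move=> /= -> ->.
  apply: ny; exists (U |` F)%fset; split.
  - by move=> W /=; rewrite in_fset1U => /orP[/eqP->//|/FU].
  - rewrite cardfsU1 in_fset_set//.
    have -> : (U \notin A) by apply/negP; rewrite inE => -[].
    by rewrite add1n.
  - by move=> W; rewrite in_fset1U => /orP[/eqP->//|/Fy].
have : (U `&` [set x; y]) z by rewrite Uz.
case=> Uz' [zx|zy]; last by rewrite zy in Uz'.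
by apply: Uy; apply: Fy; rewrite FA; split => //; rewrite -zx.
Qed.

End layers.

Lemma gruenhage_sunflower (X : topologicalType) : gruenhage_space X ->
  exists (V : nat * nat -> set (set X)) (R : nat * nat -> set X),
    (forall i, sunflower (V i) (R i)) /\
    forall x y, x <> y -> exists i U,
      V i U /\ ~ ((U `\` R i) x <-> (U `\` R i) y).
Proof.
move=> [U_ [U_open U_sep]].
exists (fun i => layer (U_ i.1) i.2), (fun i => deep (U_ i.1) i.2); split.
  by move=> i; apply: sunflower_layer; exact: U_open.
move=> x y xy; have [n [U [UU Uxy fin]]] := U_sep x y xy.
wlog finx : x y xy Uxy fin / finite_set [set U' | U_ n U' /\ U' x].
  move=> hwlog; case: (fin) => [|finy]; first exact: hwlog.
  have [||||i [W [VW sep]]] := hwlog y x; [exact: nesym| |by left|by []|].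
    by rewrite setUC.
  by exists i, W; split => // sep'; apply: sep; split; apply sep'.
have [k [W [VW sep]]] := layer_separates UU Uxy xy finx.
by exists (n, k), W.
Qed.

Section sunflower_products.
Variables (T : topologicalType) (J : Type).
Variables (V : J -> set (set T)) (R : J -> set T).

Fixpoint core (s : seq J) : set T :=
  if s is i :: s' then R i `|` core s' else set0.

(** The product of the sunflowers listed in [s]. Adding all the cores to each intersection of
    members makes the cells of the product intersections of cells of the factors. *)
Fixpoint petal (s : seq J) : set (set T) :=
  if s is i :: s' then
    [set (UW.1 `&` UW.2) `|` (R i `|` core s') |
      UW in [set UW | V i UW.1 /\ petal s' UW.2]]
  else [set setT].

Lemma sunflower_petal s : (forall i, sunflower (V i) (R i)) ->
  sunflower (petal s) (core s).
Proof.
move=> sf; elim: s => [|i s [opetal ocore subpetal interpetal]] /=.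
  split=> [_ -> ||U _|_ _ -> ->//]; [exact: openT|exact: open0|exact: sub0set].
have [oV oR subV interV] := sf i.
have oRc : open (R i `|` core s) by exact: openU.
split=> [_ [[U W] [/= VU pW] <-]||_ [[U W] [/= VU pW] <-]|] //.
  by apply: openU => //; apply: openI; [exact: oV|exact: opetal].
move=> _ _ [[U W] [/= VU pW] <-] [[U' W'] [/= VU' pW'] <-] neq x.
move=> [[[Ux Wx]|//] [[U'x W'x]|//]].
have [UU'|UU'] := pselect (U = U'); last by left; exact: (interV U U').
have [WW'|WW'] := pselect (W = W'); last by right; exact: (interpetal W W').
by case: neq; rewrite UU' WW'.
Qed.

Lemma petal_cons i s U W : V i U -> petal s W ->
  exists2 Z, petal (i :: s) Z &
    Z `\` core (i :: s) = (U `\` R i) `&` (W `\` core s).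
Proof.
move=> VU pW; exists ((U `&` W) `|` (R i `|` core s)); first by exists (U, W).
apply/seteqP; split=> x /=.
  by move=> [[[Ux Wx]|//] /not_orP[nR nc]].
by move=> [[Ux nR] [Wx nc]]; split; [left|case].
Qed.

End sunflower_products.

(** * Functionals and the masses of open sets *)

Section continuous_functions.
Variables (R : realType) (K : topologicalType) (cK : compact [set: K]).
Local Notation CK := (ctsfun R cK).

Definition to_ctsfun (f : K -> R) (cf : continuous f) : CK :=
  mkcts cf : continuousType K R.

Lemma ctsfun_max_cts (f g : CK) : continuous (fun x => Num.max (f x) (g x)).
Proof. by move=> x; apply: continuous_max; exact: ctsfun_continuous. Qed.

Lemma ctsfun_min_cts (f g : CK) : continuous (fun x => Num.min (f x) (g x)).
Proof. by move=> x; apply: continuous_min; exact: ctsfun_continuous. Qed.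

Lemma ctsfun_mul_cts (f g : CK) : continuous (fun x => f x * g x).
Proof. by move=> x; apply: cvgM; exact: ctsfun_continuous. Qed.

Definition ctsfun_max f g : CK := to_ctsfun (@ctsfun_max_cts f g).
Definition ctsfun_min f g : CK := to_ctsfun (@ctsfun_min_cts f g).
Definition ctsfun_mul f g : CK := to_ctsfun (@ctsfun_mul_cts f g).
Definition ctsfun_cst (a : R) : CK := to_ctsfun (@cst_continuous K R a).

Lemma ctsfun_addE (f g : CK) x : (f + g) x = f x + g x. Proof. by []. Qed.
Lemma ctsfun_subE (f g : CK) x : (f - g) x = f x - g x. Proof. by []. Qed.
Lemma ctsfun_scaleE a (f : CK) x : (a *: f) x = a * f x. Proof. by []. Qed.
Lemma ctsfun_maxE (f g : CK) x : ctsfun_max f g x = Num.max (f x) (g x).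
Proof. by []. Qed.
Lemma ctsfun_minE (f g : CK) x : ctsfun_min f g x = Num.min (f x) (g x).
Proof. by []. Qed.

Lemma open_ctsfun_lt (f : CK) a : open [set x | f x < a].
Proof.
apply: (@open_comp _ _ f [set y | y < a]) => [x _|]; last exact: open_lt.
exact: ctsfun_continuous.
Qed.

Lemma closed_ctsfun_ge (f : CK) a : closed [set x | a <= f x].
Proof.
have -> : [set x | a <= f x] = ~` [set x | f x < a].
  by apply/seteqP; split=> x /=; rewrite leNgt => /negP.
exact/open_closedC/open_ctsfun_lt.
Qed.

Definition subord (U : set K) (f : CK) :=
  forall x, [/\ 0 <= f x, f x <= 1 & ~ U x -> f x = 0].

(** If mu is the measure representing [phi] and [U] is open, this is the positive part of mu at [U];
    then [tvar] is the total variation of mu on [U] and [signed_mass] is mu(U). *)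
Definition mass (phi : CK -> R) (U : set K) : R :=
  sup [set phi f | f in subord U].

Definition tvar phi U := mass phi U + mass (\- phi) U.

Definition signed_mass phi U := mass phi U - mass (\- phi) U.

(** Membership in the dual ball without the operator norm; [dual_ballP] gives the equivalence. *)
Definition dual_unit (phi : CK -> R) :=
  scalar phi /\ forall f, `|phi f| <= `|f|.

Lemma subord0 U : subord U 0. Proof. by move=> x; split. Qed.

Lemma subord_mono U V f : U `<=` V -> subord U f -> subord V f.
Proof.
by move=> UV Uf x; have [f0 f1 fU] := Uf x; split=> // nV; apply: fU => /UV.
Qed.

Section dual_unit.
Variable phi : CK -> R.
Hypothesis dphi : dual_unit phi.

Lemma dual_unitD f g : phi (f + g) = phi f + phi g.
Proof. by have := dphi.1 1 f g; rewrite scale1r mul1r. Qed.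

Lemma dual_unit0 : phi 0 = 0.
Proof. by apply: (@addrI _ (phi 0)); rewrite -dual_unitD !addr0. Qed.

Lemma dual_unitZ a f : phi (a *: f) = a * phi f.
Proof. by have := dphi.1 a f 0; rewrite !addr0 dual_unit0 addr0. Qed.

Lemma dual_unitN f : phi (- f) = - phi f.
Proof. by rewrite -scaleN1r dual_unitZ mulN1r. Qed.

Lemma dual_unitB f g : phi (f - g) = phi f - phi g.
Proof. by rewrite dual_unitD dual_unitN. Qed.

Lemma dual_unit_opp : dual_unit (\- phi).
Proof.
split=> [a f g|f] /=; last by rewrite normrN; exact: dphi.2.
by rewrite dual_unitD dual_unitZ opprD mulrN.
Qed.

Lemma dual_unit_le (M : R) (f : CK) : 0 <= M -> (forall x, `|f x| <= M) ->
  `|phi f| <= M.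
Proof. by move=> M0 fM; apply: le_trans (dphi.2 f) _; exact: sup_norm_le. Qed.

Lemma subord_le1 U f : subord U f -> phi f <= 1.
Proof.
move=> Uf; apply: le_trans (ler_norm _) _; apply: dual_unit_le => // x.
by have [f0 f1 _] := Uf x; rewrite ger0_norm.
Qed.

Lemma mass_has_sup U : has_sup [set phi f | f in subord U].
Proof.
split; first by exists (phi 0), 0 => //; exact: subord0.
by exists 1 => _ [f Uf <-]; exact: subord_le1 Uf.
Qed.

Lemma mass_ub U f : subord U f -> phi f <= mass phi U.
Proof. by move=> Uf; apply: sup_upper_bound; [exact: mass_has_sup|exists f]. Qed.

Lemma mass_lub U c : (forall f, subord U f -> phi f <= c) -> mass phi U <= c.
Proof.
move=> Uc; apply: ge_sup; first by case: (mass_has_sup U).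
by move=> _ [f Uf <-]; exact: Uc.
Qed.

Lemma mass_ge0 U : 0 <= mass phi U.
Proof. by rewrite -dual_unit0; apply: mass_ub; exact: subord0. Qed.

Lemma mass_le1 U : mass phi U <= 1.
Proof. by apply: mass_lub => f; exact: subord_le1. Qed.

Lemma mass_mono U V : U `<=` V -> mass phi U <= mass phi V.
Proof.
by move=> UV; apply: mass_lub => f Uf; apply: mass_ub; exact: subord_mono Uf.
Qed.

Lemma mass_approx U e : 0 < e -> exists2 f, subord U f & mass phi U - e < phi f.
Proof.
by move=> e0; have [_ [f Uf <-] ?] := sup_adherent e0 (mass_has_sup U); exists f.
Qed.

Lemma mass_scale U (M : R) (f : CK) : 0 <= M ->
  (forall x, [/\ 0 <= f x, f x <= M & ~ U x -> f x = 0]) ->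
  phi f <= M * mass phi U.
Proof.
rewrite le_eqVlt => /orP[/eqP<-|M0] Uf.
  have -> : f = 0.
    by apply: ctsfunP => x; have [f0 fM _] := Uf x; apply/eqP; rewrite eq_le fM.
  by rewrite dual_unit0 mul0r.
rewrite -ler_pdivrMl// -dual_unitZ; apply: mass_ub => x.
have [f0 fM fU] := Uf x; rewrite ctsfun_scaleE; split.
- by rewrite mulr_ge0// invr_ge0 ltW.
- by rewrite ler_pdivrMl// mulr1.
- by move=> /fU ->; rewrite mulr0.
Qed.


Hypothesis hK : hausdorff_space K.

(** The truncation [g0] of [f] at height [d] changes [phi f] by at most [d]. A Urysohn function [w],
    equal to 1 where [d <= f] outside [U] and to 0 off [V], splits [g0] into parts subordinate to
    [V] and to [U]. *)
Lemma mass_setU U V : open U -> open V ->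
  mass phi (U `|` V) <= mass phi U + mass phi V.
Proof.
move=> oU oV; apply: mass_lub => f UVf; apply/ler_addgt0Pr => d d0.
pose A := [set x | d <= f x] `&` ~` U.
have cA : closed A.
  by apply: closedI; [exact: closed_ctsfun_ge|exact: open_closedC].
have AB : ~` V `&` A = set0.
  apply/seteqP; split=> // x [nVx [/= dfx nUx]].
  have [_ _ f0] := UVf x; move: dfx; rewrite f0 ?leNgt ?d0//.
  by case.
have us := (@normal_separatorP R K).1 (compact_normal hK cK) _ _
  (open_closedC oV) cA AB.
have [psi [cpsi psi01 psi0 psi1]] := (@uniform_separatorP _ R _ _).1 us.
pose w := to_ctsfun cpsi.
have w01 x : 0 <= w x <= 1 by have := psi01 (psi x) (ex_intro2 _ _ x I erefl).
pose g0 := ctsfun_max (f - ctsfun_cst d) 0.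
have g0E x : g0 x = Num.max (f x - d) 0 by [].
have g0P x : [/\ 0 <= g0 x, g0 x <= 1 & f x <= d -> g0 x = 0].
  rewrite g0E; have [f0 f1 _] := UVf x.
  by have [|] := leP (f x - d) 0 => ?; split => *; lra.
pose h := ctsfun_mul g0 w; pose g := g0 - h.
have hE x : h x = g0 x * w x by [].
have gE x : g x = g0 x * (1 - w x) by rewrite mulrBr mulr1.
have Vh : subord V h.
  move=> x; have := w01 x; have [? ? ?] := g0P x => /andP[? ?].
  split=> [||nV]; rewrite hE; [exact: mulr_ge0|exact: mulr_ile1|].
  by rewrite (_ : w x = 0) ?mulr0//; apply: psi0; exists x.
have Ug : subord U g.
  move=> x; have := w01 x; have [? ? gd] := g0P x => /andP[? ?].
  split=> [||nU]; rewrite gE.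
  - by apply: mulr_ge0 => //; lra.
  - by apply: mulr_ile1 => //; lra.
  - have [dfx|/ltW/gd->] := leP d (f x); last by rewrite mul0r.
    by rewrite (_ : w x = 1) ?subrr ?mulr0//; apply: psi1; exists x.
have : `|phi (f - g0)| <= d.
  apply: dual_unit_le => [|x]; first exact: ltW.
  rewrite ctsfun_subE g0E ler_norml; have [f0 _ _] := UVf x.
  by have [|] := leP (f x - d) 0 => ?; lra.
have := mass_ub Vh; have := mass_ub Ug.
by rewrite !dual_unitB ler_norml => *; lra.
Qed.

(** Finite unions [F N] are handled by subadditivity and the geometric series. For [f] subordinate
    to the whole union, the compact set where [d <= f] lies in some [F N], so the truncation of [f]
    at [d] is subordinate to [F N]. *)
Lemma mass_bigcup (G : nat -> set K) (c : R) : (forall n, open (G n)) ->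
  (forall n, mass phi (G n) <= c / 2 ^+ n.+1) -> mass phi (\bigcup_n G n) <= c.
Proof.
move=> oG Gc.
have c0 : 0 <= c.
  by have := le_trans (mass_ge0 (G 0%N)) (Gc 0%N); rewrite expr1 => *; lra.
pose F N := [set x | exists2 n, (n < N)%N & G n x].
have F_succ N : F N.+1 = F N `|` G N.
  apply/seteqP; split=> x /=.
    move=> [n]; rewrite ltnS leq_eqVlt => /orP[/eqP->|nN] Gnx; first by right.
    by left; exists n.
  by move=> [[n nN Gnx]|Gx]; [exists n; rewrite ?ltnS ?(ltnW nN)|exists N].
have oF N : open (F N).
  elim: N => [|N IH]; last by rewrite F_succ; exact: openU.
  by rewrite (_ : F 0%N = set0); [exact: open0|apply/seteqP; split=> x []].
have FN N : mass phi (F N) <= c * (1 - (2 ^+ N)^-1).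
  elim: N => [|N IH].
    rewrite expr0 invr1 subrr mulr0; apply: mass_lub => f F0f.
    rewrite (_ : f = 0) ?dual_unit0//; apply: ctsfunP => x.
    by have [_ _ ->//] := F0f x; case.
  rewrite F_succ; apply: le_trans (mass_setU (oF N) (oG N)) _.
  apply: le_trans (lerD IH (Gc N)) _.
  rewrite exprS invfM; set y := (2 ^+ N)^-1; lra.
have Fc N : mass phi (F N) <= c.
  by apply: le_trans (FN N) _; rewrite ler_piMr// gerBl invr_ge0.
apply: mass_lub => f Gf; apply/ler_addgt0Pr => d d0.
have [N FNf] : exists N, [set x | d <= f x] `<=` F N.
  apply: (@compact_ind _ _ (fun Z => exists N, Z `<=` F N)).
  - apply: (subclosed_compact _ cK) => //; exact: closed_ctsfun_ge.
  - by exists 0%N.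
  - by move=> B C BC [N CN]; exists N; exact: subset_trans CN.
  - move=> B C [N BN] [M CM]; exists (maxn N M) => x [/BN|/CM] [n nN Gx];
      by exists n => //; rewrite (leq_trans nN)// ?leq_maxl ?leq_maxr.
  - move=> x /= dfx; have [_ _ fx0] := Gf x.
    have [n _ Gnx] : (\bigcup_n G n) x.
      by apply: contrapT => /fx0 fx; rewrite fx leNgt d0 in dfx.
    exists (G n); first by apply: open_nbhs_nbhs.
    by exists n.+1 => y Gny; exists n.
pose g := ctsfun_max (f - ctsfun_cst d) 0.
have gE x : g x = Num.max (f x - d) 0 by [].
have Fg : subord (F N) g.
  move=> x; rewrite gE; have [f0 f1 _] := Gf x.
  have [|] := leP (f x - d) 0 => fd; split=> [||nF] //; try lra.
  by case: nF; apply: FNf => /=; lra.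
have : `|phi (f - g)| <= d.
  apply: dual_unit_le => [|x]; first exact: ltW.
  rewrite ctsfun_subE gE ler_norml; have [f0 _ _] := Gf x.
  by have [|] := leP (f x - d) 0 => ?; lra.
have := le_trans (mass_ub Fg) (Fc N).
by rewrite !dual_unitB ler_norml => *; lra.
Qed.

End dual_unit.

Section total_variation.
Variable phi : CK -> R.
Hypothesis dphi : dual_unit phi.
Let dnphi := dual_unit_opp dphi.

(* The decomposition of [k] is [clip k + (k - e)^+ - (- k - e)^+] where the
   first term is bounded by [e] and the two others vanish off [G]. *)
Lemma dual_unit_le_off G (k : CK) (M e : R) : 0 <= M -> 0 <= e ->
  (forall x, `|k x| <= M) -> (forall x, ~ G x -> `|k x| <= e) ->
  `|phi k| <= e + M * tvar phi G.
Proof.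
move=> M0 e0 kM kG.
pose p := ctsfun_max (k - ctsfun_cst e) 0.
pose n := ctsfun_max (- k - ctsfun_cst e) 0.
have pE x : p x = Num.max (k x - e) 0 by [].
have nE x : n x = Num.max (- k x - e) 0 by [].
have pP x : [/\ 0 <= p x, p x <= M & ~ G x -> p x = 0].
  rewrite pE; have := kM x; rewrite ler_norml => kMx.
  have [|] := leP (k x - e) 0 => ?; split=> [||/kG]; rewrite ?ler_norml => *; lra.
have nP x : [/\ 0 <= n x, n x <= M & ~ G x -> n x = 0].
  rewrite nE; have := kM x; rewrite ler_norml => kMx.
  have [|] := leP (- k x - e) 0 => ?; split=> [||/kG]; rewrite ?ler_norml => *; lra.
have : `|phi (k - p + n)| <= e.
  apply: (dual_unit_le dphi) => // x; rewrite ctsfun_addE ctsfun_subE pE nE ler_norml.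
  by have [|] := leP (k x - e) 0 => ?; have [|] := leP (- k x - e) 0 => ?; lra.
rewrite (dual_unitD dphi) (dual_unitB dphi) !ler_norml /tvar.
have := mass_scale dphi M0 pP; have := mass_scale dphi M0 nP.
have := mass_scale dnphi M0 pP; have := mass_scale dnphi M0 nP.
by rewrite /= => *; lra.
Qed.


Lemma tvar_mono U V : U `<=` V -> tvar phi U <= tvar phi V.
Proof. by move=> UV; apply: lerD; apply: mass_mono. Qed.

Hypothesis hK : hausdorff_space K.

Lemma tvar_setU U V : open U -> open V ->
  tvar phi (U `|` V) <= tvar phi U + tvar phi V.
Proof. by move=> oU oV; rewrite addrACA; apply: lerD; exact: mass_setU. Qed.

(** The positive and the negative mass are each bounded by [c], whence the doubled constant. *)
Lemma tvar_bigcup (G : nat -> set K) (c : R) : (forall n, open (G n)) ->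
  (forall n, tvar phi (G n) <= c / 2 ^+ n.+1) ->
  tvar phi (\bigcup_n G n) <= c + c.
Proof.
move=> oG Gc; apply: lerD; apply: mass_bigcup => // n;
  apply: le_trans (Gc n); rewrite /tvar ?lerDl ?lerDr; exact: mass_ge0.
Qed.

(* The function [f] is a truncated multiple of the maximum [h] of two
   functions nearly attaining the positive and negative masses of [U], and
   [G] is the part of [U] where [h] is small. *)
Lemma open_approx U e : open U -> 0 < e -> exists f G,
  [/\ subord U f, open G /\ closed (U `\` G), forall x, U x -> ~ G x -> f x = 1,
      tvar phi G <= e & `|phi f - signed_mass phi U| <= e].
Proof.
move=> oU e0; pose d := Num.min (e / 4) 1.
have [d0 d1 de] : [/\ 0 < d, d <= 1 & d <= e / 4].
  by rewrite /d; have [|] := leP (e / 4) 1 => ?; split; lra.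
have [f1 Uf1 mf1] := mass_approx dphi U d0.
have [f2 Uf2 mf2] := mass_approx dnphi U d0.
pose h := ctsfun_max f1 f2; pose k := ctsfun_min f1 f2.
pose f := ctsfun_min (d^-1 *: h) (ctsfun_cst 1); pose r := f - h.
have hk : h = f1 + f2 - k.
  apply: ctsfunP => x; rewrite ctsfun_subE ctsfun_addE ctsfun_maxE ctsfun_minE.
  by have [|] := leP (f1 x) (f2 x) => ?; lra.
have hP x : [/\ 0 <= h x, h x <= 1, ~ U x -> h x = 0, f1 x <= h x & f2 x <= h x].
  rewrite ctsfun_maxE; have [? ? f1U] := Uf1 x; have [? ? f2U] := Uf2 x.
  by have [|] := leP (f1 x) (f2 x) => ?; split=> //; lra.
have fP x : [/\ h x <= f x, f x <= 1, ~ U x -> f x = 0 & d <= h x -> f x = 1].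
  have -> : f x = Num.min (d^-1 * h x) 1 by [].
  have [h0 h1 hU _ _] := hP x.
  have hdh : h x <= d^-1 * h x by rewrite ler_peMl// invf_ge1.
  split.
  - by rewrite le_min hdh.
  - by rewrite ge_min lexx orbT.
  - by move=> /hU ->; rewrite mulr0 min_l.
  - by move=> dh; rewrite min_r// ler_pdivlMl// mulr1.
have Uf : subord U f.
  by move=> x; have [? ? ? ?] := fP x; have [? _ _ _ _] := hP x; split=> //; lra.
pose G := U `&` [set x | h x < d].
have oG : open G by apply: openI => //; exact: open_ctsfun_lt.
have UG : U `\` G = [set x | d <= h x].
  apply/seteqP; split=> x /=; rewrite leNgt.
    by move=> [Ux nG]; apply/negP => hd; exact: nG.
  move=> hd; split; last by move=> [_ /= hd']; rewrite hd' in hd.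
  by apply: contrapT => nU; have [_ _ /(_ nU) h0 _ _] := hP x; rewrite h0 d0 in hd.
(* For [g] subordinate to [G], the sum [g + f'] stays below [1 + d] because [f' <= h < d] on [G]. As
   [f'] nearly attains the mass of [U], little is left for [g]. *)
have mG p f' : dual_unit p -> subord U f' -> (forall x, f' x <= h x) ->
    mass p U - d < p f' -> mass p G <= d + d.
  move=> dp Uf' f'h mf'; apply: mass_lub => // g Gg.
  have : p (g + f') <= (1 + d) * mass p U.
    apply: mass_scale => //; first by lra.
    move=> x; rewrite ctsfun_addE.
    have [g0 g1 gG] := Gg x; have [f'0 f'1 f'U] := Uf' x; have := f'h x.
    split; [lra| |move=> nU; rewrite f'U// gG ?addr0//; by case].
    have [hd|dh] := ltP (h x) d; first by lra.
    by rewrite gG; [lra|move=> [_ /=]; rewrite ltNge dh].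
  rewrite (dual_unitD dp).
  have : d * mass p U <= d by rewrite ler_piMr ?mass_le1 ?ltW.
  by move: mf'; lra.
have mG1 := mG _ _ dphi Uf1 (fun x => let: And5 _ _ _ a _ := hP x in a) mf1.
have mG2 := mG _ _ dnphi Uf2 (fun x => let: And5 _ _ _ _ a := hP x in a) mf2.
exists f, G; split => //.
- by split=> //; rewrite UG; exact: closed_ctsfun_ge.
- move=> x Ux nG; have [_ _ _ ->//] := fP x; rewrite leNgt; apply/negP => hd.
  exact: nG.
- by rewrite /tvar; lra.
(* Subtracting [k] from [f1] and [f2], or adding [r] to them, keeps them subordinate to [U]; by
   their near maximality, [phi k] and [phi r] are then at most [d] in absolute value. *)
have kP x : [/\ 0 <= k x, k x <= f1 x & k x <= f2 x].
  rewrite ctsfun_minE; have [? _ _] := Uf1 x; have [? _ _] := Uf2 x.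
  by have [|] := leP (f1 x) (f2 x) => ?; split=> //; lra.
have Uk1 : subord U (f1 - k).
  move=> x; rewrite ctsfun_subE; have [? ? f1U] := Uf1 x; have [? ? ?] := kP x.
  by split=> [||/f1U]; lra.
have Uk2 : subord U (f2 - k).
  move=> x; rewrite ctsfun_subE; have [? ? f2U] := Uf2 x; have [? ? ?] := kP x.
  by split=> [||/f2U]; lra.
have Ur1 : subord U (f1 + r).
  move=> x; rewrite ctsfun_addE ctsfun_subE; have [? ? f1U] := Uf1 x.
  have [? ? fU _] := fP x; have [? ? hU ? ?] := hP x.
  by split=> [||nU]; [lra|lra|rewrite fU// f1U// hU//; lra].
have Ur2 : subord U (f2 + r).
  move=> x; rewrite ctsfun_addE ctsfun_subE; have [? ? f2U] := Uf2 x.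
  have [? ? fU _] := fP x; have [? ? hU ? ?] := hP x.
  by split=> [||nU]; [lra|lra|rewrite fU// f2U// hU//; lra].
have := mass_ub dphi Uk1; have := mass_ub dnphi Uk2.
have := mass_ub dphi Ur1; have := mass_ub dnphi Ur2.
have := mass_ub dphi Uf1; have := mass_ub dnphi Uf2.
rewrite /= /r hk !(dual_unitD dphi, dual_unitN dphi) /signed_mass ler_norml.
move: mf1 mf2 => /=; lra.
Qed.

End total_variation.

End continuous_functions.
Arguments ctsfun_cst {R K cK}.

(** * Integration of discontinuous functions by Lusin approximation *)

Section lusin.
Variables (R : realType) (K : topologicalType) (cK : compact [set: K]).
Hypothesis hK : hausdorff_space K.
Local Notation CK := (ctsfun R cK).
Variable phi : CK -> R.
Hypothesis dphi : dual_unit phi.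

(* [lusin h v] says that [h] is integrable with integral [v] for the measure
   representing [phi]. *)
Definition lusin (h : K -> R) (v : R) :=
  exists2 M, 0 <= M & forall e, 0 < e -> exists (f : CK) G,
    [/\ open G, tvar phi G <= e, forall x, `|h x - f x| <= M,
        forall x, ~ G x -> `|h x - f x| <= e & `|phi f - v| <= e].

Lemma lusinD h1 v1 h2 v2 : lusin h1 v1 -> lusin h2 v2 ->
  lusin (fun x => h1 x + h2 x) (v1 + v2).
Proof.
move=> [M1 M10 H1] [M2 M20 H2]; exists (M1 + M2); first exact: addr_ge0.
move=> e e0; have e20 : 0 < e / 2 by lra.
have [f1 [G1 [oG1 t1 hM1 he1 v1e]]] := H1 _ e20.
have [f2 [G2 [oG2 t2 hM2 he2 v2e]]] := H2 _ e20.
exists (f1 + f2), (G1 `|` G2); split.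
- exact: openU.
- by apply: le_trans (tvar_setU dphi hK oG1 oG2) _; lra.
- move=> x; rewrite ctsfun_addE opprD addrACA.
  by apply: le_trans (ler_normD _ _) _; exact: lerD.
- move=> x /not_orP[nG1 nG2]; rewrite ctsfun_addE opprD addrACA.
  apply: le_trans (ler_normD _ _) _.
  by have := he1 x nG1; have := he2 x nG2; lra.
- rewrite (dual_unitD dphi) opprD addrACA.
  by apply: le_trans (ler_normD _ _) _; lra.
Qed.

Lemma lusinZ a h v : lusin h v -> lusin (fun x => a * h x) (a * v).
Proof.
move=> [M M0 H]; exists (`|a| * M); first exact: mulr_ge0.
move=> e e0; have a0 : 0 < `|a| + 1 by rewrite ltr_wpDl.
have ea0 : 0 < e / (`|a| + 1) by exact: divr_gt0.
have ale y : `|y| <= e / (`|a| + 1) -> `|a * y| <= e.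
  move=> ye; rewrite normrM; apply: le_trans (_ : (`|a| + 1) * `|y| <= _).
    by rewrite ler_wpM2r// lerDl.
  by rewrite -ler_pdivlMl// mulrC.
have [f [G [oG t hM he ve]]] := H _ ea0.
exists (a *: f), G; split => //.
- by apply: le_trans t _; rewrite ler_pdivrMr// ler_peMr ?lerDr// ltW.
- by move=> x; rewrite ctsfun_scaleE -mulrBr normrM ler_wpM2l.
- by move=> x nG; rewrite ctsfun_scaleE -mulrBr; apply/ale/he.
- by rewrite (dual_unitZ dphi) -mulrBr; exact: ale.
Qed.

Lemma lusin_open U : open U -> lusin \1_U (signed_mass phi U).
Proof.
move=> oU; exists 1 => // e e0.
have [f [G [Uf [oG _] f1 tG fU]]] := open_approx dphi oU e0.
exists f, G; split=> // x.
  rewrite indicE ler_norml; have [? ? ?] := Uf x.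
  by case: (x \in U) => /=; lra.
move=> nG; rewrite indicE; have [? ? f0] := Uf x.
have [xU|xU] := boolP (x \in U).
  by rewrite f1// ?subrr ?normr0 ?ltW//; exact/set_mem.
by rewrite f0 ?subrr ?normr0 ?ltW// => Ux; rewrite mem_set in xU.
Qed.

(** The bound does not involve the constant hidden in [lusin h v], so [e] can be fixed before [h] is
    known: that constant only gets multiplied by the variation of [G'], which is arbitrarily
    small. *)
Lemma lusin_compare h v (f : CK) G (M e : R) :
  lusin h v -> open G -> 0 <= M -> 0 <= e ->
  tvar phi G <= e -> (forall x, `|f x - h x| <= M) ->
  (forall x, ~ G x -> `|f x - h x| <= e) ->
  `|phi f - v| <= e + M * e.
Proof.
move=> [M' M'0 H] oG M0 e0 tG fM fe; apply/ler_addgt0Pr => d d0.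
(* Collects the coefficients of [d'] in the final estimate, with [d' * d'] bounded by [d']. *)
pose C := 3 + M + M + M' + e.
have C0 : 0 < C by rewrite /C; lra.
pose d' := Num.min (d / C) 1.
have [d'0 d'1 dC] : [/\ 0 < d', d' <= 1 & C * d' <= d].
  rewrite /d' ge_min lexx orbT lt_min ltr01 divr_gt0//; split=> //.
  by rewrite mulrC -ler_pdivlMr// ge_min lexx.
have [f' [G' [oG' tG' hM he ve]]] := H _ d'0.
pose k := f - f'.
have normD x : `|k x| <= `|f x - h x| + `|h x - f' x|.
  by rewrite ctsfun_subE; apply: le_trans (ler_normD _ _); rewrite addrA subrK.
(* Truncation of [k] at height [M + d'], which [k] can exceed only on [G']; thus [k - c] vanishes
   off [G']. *)
pose c := ctsfun_max (ctsfun_min k (ctsfun_cst (M + d')))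
  (ctsfun_cst (- (M + d'))).
have cE x : c x = Num.max (Num.min (k x) (M + d')) (- (M + d')) by [].
have phic : `|phi c| <= (e + d') + (M + d') * tvar phi (G `|` G').
  apply: dual_unit_le_off => // [||x|x /not_orP[nG nG']]; [lra|lra| |].
    rewrite cE ler_norml; have [|] := leP (k x) (M + d') => ?.
      by have [|] := leP (k x) (- (M + d')) => ?; lra.
    by have [|] := leP (M + d') (- (M + d')) => ?; lra.
  have : `|k x| <= e + d'.
    by apply: le_trans (normD x) _; apply: lerD; [exact: fe|exact: he].
  rewrite cE !ler_norml; have [|] := leP (k x) (M + d') => ?.
    by have [|] := leP (k x) (- (M + d')) => ? ?; lra.
  by have [|] := leP (M + d') (- (M + d')) => ? ?; lra.
have phikc : `|phi (k - c)| <= 0 + (M + M') * tvar phi G'.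
  apply: dual_unit_le_off => // [|x|x nG']; [lra| |].
    have : `|k x| <= M + M'.
      by apply: le_trans (normD x) _; exact: lerD.
    rewrite ctsfun_subE cE !ler_norml; have [|] := leP (k x) (M + d') => ?.
      by have [|] := leP (k x) (- (M + d')) => ? ?; lra.
    by have [|] := leP (M + d') (- (M + d')) => ? ?; lra.
  have : `|k x| <= M + d'.
    by apply: le_trans (normD x) _; apply: lerD; [exact: fM|exact: he].
  rewrite ctsfun_subE cE !ler_norml; have [|] := leP (k x) (M + d') => ?.
    by have [|] := leP (k x) (- (M + d')) => ? ?; lra.
  by have [|] := leP (M + d') (- (M + d')) => ? ?; lra.
have -> : phi f - v = phi c + (phi (k - c) + (phi f' - v)).
  by rewrite !(dual_unitB dphi); lra.
have b1 : (M + d') * tvar phi (G `|` G') <= (M + d') * (e + d').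
  rewrite ler_wpM2l//; first by lra.
  by apply: le_trans (tvar_setU dphi hK oG oG') _; exact: lerD.
have b2 : (M + M') * tvar phi G' <= (M + M') * d'.
  by rewrite ler_wpM2l//; lra.
have b3 : d' * d' <= d' by rewrite ler_piMr// ltW.
apply: le_trans (ler_normD _ _) _; have := ler_normD (phi (k - c)) (phi f' - v).
move: phic phikc b1 b2 b3 dC ve; rewrite /C !(mulrDl, mulrDr) !mul1r (mulrC d' e).
lra.
Qed.

Lemma lusin_ext h h' v : h =1 h' -> lusin h v -> lusin h' v.
Proof. by move=> /funext ->. Qed.

Lemma lusin_setD (U V : set K) : open U -> open V -> V `<=` U ->
  lusin \1_(U `\` V) (signed_mass phi U - signed_mass phi V).
Proof.
move=> oU oV VU; rewrite -[- signed_mass phi V]mulN1r.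
apply: (lusin_ext _ (lusinD (lusin_open oU) (lusinZ (-1) (lusin_open oV)))).
move=> x; rewrite !indicE in_setD; have [xV|xV] := boolP (x \in V) => /=.
  by rewrite andbF mem_set ?mulr1 ?subrr//; apply: VU; exact/set_mem.
by rewrite andbT mulr0 addr0.
Qed.

End lusin.

(** * Density of the algebra generated by the cells *)

Inductive indicator_algebra (R : realType) (K : Type) (C : set (set K)) :
    (K -> R) -> Prop :=
| indicator_algebra_cst a : indicator_algebra C (cst a)
| indicator_algebra_indic D : C D -> indicator_algebra C \1_D
| indicator_algebraD f g : indicator_algebra C f -> indicator_algebra C g ->
    indicator_algebra C (fun x => f x + g x)
| indicator_algebraM f g : indicator_algebra C f -> indicator_algebra C g ->
    indicator_algebra C (fun x => f x * g x).

Section density.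
Variables (R : realType) (K : topologicalType) (C : set (set K)) (G : set K).
Local Notation alg := (@indicator_algebra R K C).

Lemma alg_ext (f g : K -> R) : f =1 g -> alg f -> alg g.
Proof. by move=> /funext ->. Qed.

Lemma alg_setC (D : set K) : alg \1_D -> alg \1_(~` D).
Proof.
move=> aD; apply: (alg_ext _ (indicator_algebraD (indicator_algebra_cst C 1)
  (indicator_algebraM (indicator_algebra_cst C (-1)) aD))) => x.
by rewrite !indicE in_setC; case: (x \in D) => /=; lra.
Qed.

Lemma alg_setI (D E : set K) : alg \1_D -> alg \1_E -> alg \1_(D `&` E).
Proof.
move=> aD aE; apply: (alg_ext _ (indicator_algebraM aD aE)) => x.
by rewrite !indicE in_setI; case: (x \in D); case: (x \in E) => /=; lra.
Qed.

Hypothesis C_clopen : forall D, C D -> open (D `|` G) /\ open (~` D `|` G).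
Hypothesis C_sep : forall x y, ~ G x -> ~ G y -> x <> y ->
  exists2 D, C D & ~ (D x <-> D y).
Hypothesis oG : open G.
Hypothesis cG : compact (~` G).

(** Each point off [G] where [f] differs from [f x] by at least [e] is separated from [x] by a cell
    or its complement. By compactness finitely many of these suffice, and [B] is their
    intersection. *)
Lemma small_cell (f : K -> R) x (e : R) : continuous f -> ~ G x -> 0 < e ->
  exists B, [/\ alg \1_B, open (B `|` G), B x &
    forall y, ~ G y -> B y -> `|f x - f y| < e].
Proof.
move=> cf nGx e0.
pose P (Z : set K) := exists B, [/\ alg \1_B, open (B `|` G), B x &
  Z `&` B `<=` G].
have [B [aB oB Bx BZ]] : P (~` G `&` [set y | e <= `|f x - f y|]).
  apply: compact_ind.
  - apply: (subclosed_compact _ cG); last by move=> y [].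
    apply: closedI; first exact: open_closedC.
    have -> : [set y | e <= `|f x - f y|] = ~` (f @^-1` ball (f x) e).
      by apply/seteqP; split=> y /=; rewrite leNgt => /negP.
    by apply/open_closedC/open_comp; [move=> y _; exact: cf|exact: ball_open].
  - exists setT; split => //; last by rewrite set0I.
      by rewrite indicT; exact: indicator_algebra_cst.
    by rewrite setTU; exact: openT.
  - move=> Y Z YZ [B [aB oB Bx BZ]]; exists B; split=> //.
    by apply: subset_trans BZ; exact: setSI.
  - move=> Y Z [B [aB oB Bx BY]] [D [aD oD Dx DZ]]; exists (B `&` D); split=> //.
    + exact: alg_setI.
    + by rewrite setUIl; exact: openI.
    + by move=> y [[Yy|Zy] [By Dy]]; [exact: BY|exact: DZ].
  - move=> y [nGy /= fxy].
    have xy : x <> y by move=> xy; rewrite xy subrr normr0 leNgt e0 in fxy.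
    have [D CD sep] := C_sep nGx nGy xy.
    have aD : alg \1_D by exact: indicator_algebra_indic.
    have [oD oD'] := C_clopen CD.
    have [Dx|nDx] := pselect (D x).
      exists (~` D `|` G); last by exists D; split=> // z [[]].
      apply: open_nbhs_nbhs; split=> //; left => Dy; exact: sep.
    exists (D `|` G).
      by apply: open_nbhs_nbhs; split=> //; left; apply: contrapT => nDy; apply: sep.
    exists (~` D); split => //; first exact: alg_setC.
    by move=> z [[]].
exists B; split=> // y nGy By; rewrite ltNge; apply/negP => fxy.
by apply: (nGy); apply: BZ.
Qed.

(** The complement of [G] is covered by finitely many sets from [small_cell], on each of which [f]
    is nearly constant; [g] is a step function built from values of [f]. *)
Lemma indicator_algebra_dense (f : K -> R) (M e : R) : continuous f -> 0 < e ->
  (forall x, `|f x| <= M) -> exists g,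
  [/\ alg g, forall x, `|g x| <= M & forall x, ~ G x -> `|f x - g x| <= e].
Proof.
move=> cf e0 fM.
pose P (Z : set K) := exists D g, [/\ alg \1_D, alg g, forall x, `|g x| <= M,
  Z `<=` D `|` G & forall x, ~ G x -> D x -> `|f x - g x| <= e].
have [D [g [aD ag gM GD fge]]] : P (~` G).
  apply: compact_ind => //.
  - exists set0, (cst 0); split=> //; last first.
    + by move=> x; rewrite normr0; apply: le_trans (fM x).
    + exact: indicator_algebra_cst.
    + by rewrite indic0; exact: indicator_algebra_cst.
  - move=> Y Z YZ [D [g [aD ag gM ZD fge]]]; exists D, g; split=> //.
    exact: subset_trans ZD.
  - move=> Y Z [D [g [aD ag gM YD fge]]] [D' [g' [aD' ag' gM' ZD' fge']]].
    (* Taking [g] on [D] and [g'] elsewhere preserves the bound [M]. *)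
    exists (~` (~` D `&` ~` D')), (fun x => \1_D x * g x + \1_(~` D) x * g' x).
    split.
    + by apply/alg_setC/alg_setI; exact: alg_setC.
    + by apply: indicator_algebraD; apply: indicator_algebraM => //; exact: alg_setC.
    + move=> x; rewrite !indicE in_setC; case: (x \in D) => /=.
        by rewrite mul1r mul0r addr0.
      by rewrite mul1r mul0r add0r.
    + move=> x; rewrite -setCU setCK => -[/YD|/ZD'] [?|?]; [|by right| |by right].
        by left; left.
      by left; right.
    + move=> x nGx; rewrite -setCU setCK !indicE in_setC => DD'.
      have [xD|xD] := boolP (x \in D) => /=.
        by rewrite mul1r mul0r addr0; apply: fge => //; exact/set_mem.
      rewrite mul1r mul0r add0r; apply: fge' => //.
      by case: DD' => // Dx; rewrite mem_set in xD.
  - move=> x nGx; have [B [aB oB Bx fB]] := small_cell cf nGx e0.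
    exists (B `|` G); first by apply: open_nbhs_nbhs; split=> //; left.
    exists B, (cst (f x)); split=> [||y||] //; first exact: indicator_algebra_cst.
      exact: fM.
    by move=> y nGy By /=; rewrite distrC ltW// fB.
exists g; split=> // x nGx; apply: fge => //.
by have [] := GD x nGx.
Qed.

End density.

(** * Functionals are determined by the signed masses of petals and cores *)

Section uniqueness.
Variables (R : realType) (K : topologicalType) (cK : compact [set: K]).
Hypothesis hK : hausdorff_space K.
Local Notation CK := (ctsfun R cK).
Variables phi psi : CK -> R.
Hypotheses (dphi : dual_unit phi) (dpsi : dual_unit psi).

(** [open_approx] provides a small open set for each [U_ j] and each functional. The two sets for
    one [U_ j] can be intersected, since removing the intersection leaves a union of two closed
    sets; summable bounds then allow the union over all [j]. *)
Lemma small_open_closing (J : countType) (U_ : J -> set K) (e : R) :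
  (forall j, open (U_ j)) -> 0 < e -> exists G,
  [/\ open G, tvar phi G <= e, tvar psi G <= e & forall j, closed (U_ j `\` G)].
Proof.
move=> oU e0.
pose V n := if choice.unpickle n is Some j then U_ j else set0.
have oV n : open (V n).
  by rewrite /V; case: choice.unpickle => [j|]; [exact: oU|exact: open0].
have e20 n : 0 < (e / 2) / 2 ^+ n.+1 by rewrite !divr_gt0// exprn_gt0.
have /choice[G GP] : forall n, exists G, [/\ open G,
    tvar phi G <= (e / 2) / 2 ^+ n.+1, tvar psi G <= (e / 2) / 2 ^+ n.+1 &
    closed (V n `\` G)].
  move=> n; have [_ [G1 [_ [oG1 cG1] _ t1 _]]] := open_approx dphi (oV n) (e20 n).
  have [_ [G2 [_ [oG2 cG2] _ t2 _]]] := open_approx dpsi (oV n) (e20 n).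
  exists (G1 `&` G2); split.
  - exact: openI.
  - by apply: le_trans t1; apply: tvar_mono => // x [].
  - by apply: le_trans t2; apply: tvar_mono => // x [].
  - by rewrite setDIr; exact: closedU.
exists (\bigcup_n G n); split.
- by apply: bigcup_open => n _; have [] := GP n.
- rewrite [leRHS](splitr e); apply: tvar_bigcup => // n; by have [] := GP n.
- rewrite [leRHS](splitr e); apply: tvar_bigcup => // n; by have [] := GP n.
move=> j; pose n := choice.pickle j.
have -> : U_ j `\` \bigcup_n G n = (V n `\` G n) `&` ~` \bigcup_n G n.
  rewrite /V /n choice.pickleK; apply/seteqP; split=> x.
    by move=> [Ux nG]; split=> //; split=> // Gx; apply: nG; exists n.
  by move=> [[]].
apply: closedI; first by have [] := GP n.
by apply/open_closedC/bigcup_open => k _; have [] := GP k.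
Qed.

Variables (J : countType) (V : J -> set (set K)) (C_ : J -> set K).
Hypothesis sf : forall i, sunflower (V i) (C_ i).
Hypothesis sep : forall x y, x <> y ->
  exists i U, V i U /\ ~ ((U `\` C_ i) x <-> (U `\` C_ i) y).

Let cells : set (set K) := [set D | exists i U, V i U /\ D = U `\` C_ i].

Hypothesis agree_core : forall s,
  signed_mass phi (core C_ s) = signed_mass psi (core C_ s).
Hypothesis agree_petal : forall s T, petal V C_ s T ->
  signed_mass phi T = signed_mass psi T.

Let common (h : K -> R) := exists v, lusin phi h v /\ lusin psi h v.

Let commonD h1 h2 : common h1 -> common h2 -> common (fun x => h1 x + h2 x).
Proof.
by move=> [v1 [? ?]] [v2 [? ?]]; exists (v1 + v2); split; exact: lusinD.
Qed.

Let common_ext h h' : h =1 h' -> common h -> common h'.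
Proof. by move=> /funext ->. Qed.

(* The indicators of [T `\` core C_ s], [T] a petal, are closed under products,
   so [cell_stable] is preserved by multiplication by an indicator of a cell. *)
Let cell_stable (h : K -> R) := forall s T, petal V C_ s T ->
  common (fun x => h x * \1_(T `\` core C_ s) x).

Let cell_stable_alg g : indicator_algebra cells g ->
  forall h, cell_stable h -> cell_stable (fun x => g x * h x).
Proof.
elim=> {g} [a|D [i [U [VU ->]]]|f g _ IHf _ IHg|f g _ IHf _ IHg] h hM s T pT.
- have [v [? ?]] := hM s T pT; exists (a * v); split;
    (apply: lusin_ext; last by apply: lusinZ; eassumption) => x /=;
    by rewrite mulrA.
- have [Z pZ ZE] := petal_cons VU pT.
  apply: common_ext (hM _ _ pZ) => x; rewrite ZE !indicE in_setI.
  by case: (x \in U `\` _); case: (x \in T `\` _) => /=; ring.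
- apply: common_ext (commonD (IHf h hM s T pT) (IHg h hM s T pT)) => x /=.
  by ring.
- apply: common_ext (IHf _ (IHg h hM) s T pT) => x /=; ring.
Qed.

Let common_alg g : indicator_algebra cells g -> common g.
Proof.
move=> ag; have one : cell_stable (cst 1).
  move=> s T pT; have [oP oC CP _] := sunflower_petal s sf.
  exists (signed_mass phi T - signed_mass phi (core C_ s)).
  have oneE : \1_(T `\` core C_ s) =1
      (fun x => cst 1 x * (\1_(T `\` core C_ s) x : R)).
    by move=> x; rewrite mul1r.
  split; first by apply: lusin_ext oneE _; apply: lusin_setD; auto.
  rewrite (agree_petal pT) agree_core.
  by apply: lusin_ext oneE _; apply: lusin_setD; auto.
(* The empty product has the single petal [setT] and empty core, so its cell is all of [K]. *)
have := cell_stable_alg ag one (s := [::]) (T := setT) erefl.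
apply: common_ext => x; rewrite /= setD0 indicE in_setT /= !mulr1//.
Qed.

(** Off a small open [G], [f] is uniformly close to some [g] in the algebra of the cells. As [g] has
    the same integral [v] for both functionals, [phi f] and [psi f] are both close to [v]. *)
Lemma dual_unit_unique f : phi f = psi f.
Proof.
apply/eqP; rewrite -subr_eq0 -normr_le0; apply/ler_addgt0Pr => d d0.
rewrite add0r; pose M := `|f|; have M0 : 0 <= M by exact: normr_ge0.
have fM x : `|f x| <= M by exact: ctsfun_le_norm.
pose e := d / (2 * (1 + (M + M))).
have C0 : 0 < 2 * (1 + (M + M)) by lra.
have e0 : 0 < e by exact: divr_gt0.
(* A sunflower may have uncountably many members; closing off only its union and its core keeps the
   family countable and still makes all cells clopen off [G]. *)
pose U_ (j : J * bool) := if j.2 then \bigcup_(U in V j.1) U else C_ j.1.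
have oU j : open (U_ j).
  rewrite /U_; have [oV oC _ _] := sf j.1; case: j.2 => //.
  exact: bigcup_open.
have [G [oG tG tG' cUG]] := small_open_closing oU e0.
have Gclopen D : cells D -> open (D `|` G) /\ open (~` D `|` G).
  move=> [i [U [VU ->]]]; have [oV oC _ VC] := sf i.
  have oE : open (~` (\bigcup_(U in V i) U `\` G)).
    exact/closed_openC/(cUG (i, true)).
  have oR : open (~` (C_ i `\` G)) by exact/closed_openC/(cUG (i, false)).
  split.
    have -> : U `\` C_ i `|` G = (U `&` ~` (C_ i `\` G)) `|` G.
      apply/seteqP; split=> x [|]; [|by right| |by right].
        by move=> [Ux nC]; left; split=> // -[].
      move=> [Ux nCG]; have [Gx|nG] := pselect (G x); [by right|left].
      by split=> // Cx; apply: nCG.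
    by apply: openU => //; apply: openI => //; exact: oV.
  (* Outside a cell lie the core, the other members and the complement of the union of all
     members. *)
  have -> : ~` (U `\` C_ i) `|` G = ~` (\bigcup_(U in V i) U `\` G) `|`
      (C_ i `|` \bigcup_(W in [set W | V i W /\ W <> U]) W) `|` G.
    apply/seteqP; split=> x.
      move=> [nUC|]; last by right.
      have [Cx|nC] := pselect (C_ i x); first by left; right; left.
      have [[W VW Wx]|nE] := pselect ((\bigcup_(U in V i) U) x).
        left; right; right; exists W => //; split=> // WU; apply: nUC.
        by rewrite -WU.
      by left; left => -[].
    move=> [[nEG|[Cx|[W [VW WU] Wx]]]|]; last by right.
    - have [Gx|nG] := pselect (G x); [by right|left].
      by move=> [Ux _]; apply: nEG; split=> //; exists U.
    - by left => -[].
    - by left => -[Ux nC]; apply: nC; apply: (VC W U).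
  apply: openU => //; apply: openU => //; apply: openU => //.
  by apply: bigcup_open => W [VW _]; exact: oV.
have Gsep x y : ~ G x -> ~ G y -> x <> y -> exists2 D, cells D & ~ (D x <-> D y).
  move=> _ _ xy; have [i [U [VU Uxy]]] := sep xy.
  by exists (U `\` C_ i) => //; exists i, U.
have cG : compact (~` G) by apply: subclosed_compact cK _ => //; exact: open_closedC.
have [g [ag gM fg]] := indicator_algebra_dense Gclopen Gsep oG cG
  (@ctsfun_continuous _ _ cK f) e0 fM.
have fgM x : `|f x - g x| <= M + M.
  by apply: le_trans (ler_normB _ _) _; exact: lerD.
have [v [phiv psiv]] := common_alg ag.
have MM0 : 0 <= M + M by exact: addr_ge0.
have b1 := lusin_compare hK dphi phiv oG MM0 (ltW e0) tG fgM fg.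
have b2 := lusin_compare hK dpsi psiv oG MM0 (ltW e0) tG' fgM fg.
have -> : phi f - psi f = (phi f - v) - (psi f - v) by lra.
apply: le_trans (ler_normB _ _) _; apply: le_trans (lerD b1 b2) _.
have -> : d = e * (2 * (1 + (M + M))) by rewrite divfK// gt_eqF.
by lra.
Qed.

End uniqueness.

(** * The weak* topology of the dual ball *)

Section set_type_topology.
Variables (T : topologicalType) (A : set T).

Lemma set_val_continuous : continuous (set_val : set_type A -> T).
Proof. exact: initial_continuous. Qed.

Lemma compact_set_type : compact A -> compact [set: set_type A].
Proof.
move=> cA F FF _; pose F' := (set_val : set_type A -> T) @ F.
have F'A : F' A.
  by apply: (@filterS _ F _ setT) => [x _|]; [exact: set_valP|exact: filterT].
have [p [Ap clp]] := cA F' _ F'A.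
exists (exist _ p (mem_set Ap)); split=> // P Q FP.
rewrite nbhsE => -[_ [[W oW <-] Wp] WQ].
have F'P : F' (set_val @` P) by apply: (@filterS _ F _ P) => // x Px; exists x.
have [_ [[x Px <-] Wx]] := clp _ _ F'P (open_nbhs_nbhs (conj oW Wp)).
by exists x; split=> //; exact: WQ.
Qed.

Lemma hausdorff_set_type : hausdorff_space T -> hausdorff_space (set_type A).
Proof.
move=> hT p q clpq; apply: val_inj; apply: hT => P Q Pp Qq.
have [x [Px Qx]] := clpq _ _ (set_val_continuous Pp) (set_val_continuous Qq).
by exists (set_val x).
Qed.

End set_type_topology.

Lemma closed_scalar_eq (R : realType) (T : topologicalType) (a : R)
    (F G H : T -> R) : continuous F -> continuous G -> continuous H ->
  closed [set x | F x - (a * G x + H x) = 0].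
Proof.
move=> cF cG cH.
have cE : continuous (fun x => F x - (a * G x + H x)).
  move=> x; apply: cvgB; first exact: cF.
  by apply: cvgD; [apply: cvgMl_tmp; exact: cG|exact: cH].
by apply: (@preimage_closed _ _ _ [set 0]) => [x _|];
  [exact: cE|exact: closed_eq].
Qed.

Lemma closed_norm_le (R : realType) (T : topologicalType) (M : R)
    (F : T -> R) : continuous F -> closed [set x | `|F x| <= M].
Proof.
move=> cF; have cE : continuous (fun x => `|F x|).
  by move=> x; apply: cvg_norm; exact: cF.
by apply: (@preimage_closed _ _ _ [set y | y <= M]) => [x _|];
  [exact: cE|exact: closed_le].
Qed.

Section dual_ball.
Variables (R : realType) (V : normedModType R).

Lemma dual_ballP (phi : {ptws V -> R}) :
  dual_ball V phi <-> scalar (phi : V -> R) /\ forall v, `|phi v| <= `|v|.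
Proof.
have scal0 : scalar (phi : V -> R) -> forall a v, phi (a *: v) = a * phi v.
  move=> lin a v; have phi0 : phi 0 = 0.
    apply: (@addrI _ (phi 0)); have := lin 1 0 0.
    by rewrite scaler0 mul1r !addr0 => <-.
  by have := lin a v 0; rewrite !addr0 phi0 addr0.
split=> [[[lin cphi] norm1]|[lin philt]].
  split=> // v; have phiZ := scal0 lin.
  (* Continuity at 0 bounds [phi] on the unit ball; without a bound, [sup] in [dual_norm] would be a
     default value and not an upper bound. *)
  have [d /= d0 dP] : exists2 d : R, 0 < d & forall v, `|v| < d -> `|phi v| < 1.
    have := cphi 0; rewrite /continuous_at => /cvgrPdist_lt/(_ 1 ltr01).
    move=> /nbhs_norm0P[d /= d0 dP]; exists d => // w wd.
    have := dP w wd; rewrite /= -(scale0r 0) phiZ mul0r sub0r normrN; apply.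
  have bound w : `|w| <= 1 -> `|phi w| <= 2 / d.
    move=> w1; have := dP ((d / 2) *: w).
    rewrite phiZ normrZ (normrM (d / 2)) (gtr0_norm (_ : 0 < d / 2)) ?divr_gt0//.
    move=> /(_ _)/ltW; rewrite -ler_pdivlMl ?divr_gt0// invf_div mulr1; apply.
    apply: le_lt_trans (_ : d / 2 * 1 < d); first by rewrite ler_pM2l// divr_gt0.
    by lra.
  have le1 w : `|w| <= 1 -> `|phi w| <= 1.
    move=> w1; apply: le_trans norm1; apply: sup_upper_bound; last by exists w.
    split; first by exists `|phi w|, w.
    by exists (2 / d) => _ [u u1 <-]; exact: bound.
  have [->|v0] := eqVneq v 0.
    by rewrite -(scale0r 0) phiZ mul0r !normr0 scale0r normr0.
  have := le1 (`|v|^-1 *: v).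
  rewrite phiZ normrZ (normrM `|v|^-1) normfV normr_id mulVf ?normr_eq0// => /(_ (lexx _)).
  by rewrite ler_pdivrMl ?normr_gt0// mulr1.
split; first split=> //.
- move=> x; apply/cvgrPdist_lt => e e0; near=> t.
  have -> : phi x - phi t = phi (x - t).
    by rewrite [x - t]addrC -(scaleN1r t) lin mulN1r addrC.
  apply: le_lt_trans (philt _) _; near: t.
  exact: cvgr_dist_lt.
- apply: ge_sup; first by exists `|phi 0|, 0 => //=; rewrite normr0.
  by move=> _ [v v1 <-]; exact: le_trans (philt v) v1.
Unshelve. all: by end_near. Qed.

Lemma eval_continuous (v : V) :
  continuous ((fun phi => phi v) : {ptws V -> R} -> R).
Proof. exact: proj_continuous. Qed.

Lemma weak_star_eval_continuous (v : V) :
  continuous ((fun phi => (set_val phi : V -> R) v) : weak_star_ball V -> R).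
Proof.
move=> phi; apply: (@continuous_comp _ _ _ (set_val : weak_star_ball V -> _)
  (fun g : {ptws V -> R} => g v)); first exact: set_val_continuous.
exact: eval_continuous.
Qed.

(** Banach-Alaoglu: the ball is cut out of a product of segments, compact by Tychonoff, by closed
    conditions on evaluations. *)
Lemma compact_dual_ball : compact (dual_ball V).
Proof.
pose box := [set phi : {ptws V -> R} | 
  forall v, [set` `[- `|v|, `|v|]] (phi v)].
apply: (@subclosed_compact _ _ box); last 2 first.
- apply: (@tychonoff V (fun=> R) (fun v => [set` `[- `|v|, `|v|]])) => v.
  exact: segment_compact.
- by move=> phi /dual_ballP[_ bnd] v /=; rewrite in_itv /= -ler_norml.
have -> : dual_ball V =
    \bigcap_(t : R * V * V) [set phi : {ptws V -> R} |
      phi (t.1.1 *: t.1.2 + t.2) - (t.1.1 * phi t.1.2 + phi t.2) = 0] `&`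
    \bigcap_(v : V) [set phi : {ptws V -> R} | `|phi v| <= `|v|].
  apply/seteqP; split=> phi.
    move=> /dual_ballP[lin bnd]; split=> [[[a u] v] _|v _] //=.
    by rewrite lin subrr.
  move=> [lin bnd]; apply/dual_ballP; split=> [a u v|v]; last exact: bnd.
  by apply/eqP; rewrite -subr_eq0; apply/eqP; exact: (lin (a, u, v)).
apply: closedI; apply: closed_bigI; [move=> [[a u] v] _ /=|move=> v _ /=].
  apply: (@closed_scalar_eq R _ a) => //; exact: eval_continuous.
apply: (@closed_norm_le R _ `|v|); exact: eval_continuous.
Qed.

End dual_ball.

Lemma gruenhage_countType (X : topologicalType) (J : countType)
    (W : J -> set (set X)) :
  (forall i U, W i U -> open U) ->
  (forall x y, x <> y -> exists i U, [/\ W i U,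
    exists z, U `&` [set x; y] = [set z] &
    finite_set [set U' | W i U' /\ U' x] \/
    finite_set [set U' | W i U' /\ U' y]]) ->
  gruenhage_space X.
Proof.
move=> oW sepW.
exists (fun n => if choice.unpickle n is Some i then W i else set0).
split=> [n U|x y /sepW[i [U WU]]]; first by case: choice.unpickle => // i; exact: oW.
by exists (choice.pickle i), U; rewrite choice.pickleK.
Qed.

Lemma open_preimage_gt (R : realType) (T : topologicalType) (F : T -> R) (q : R) :
  continuous F -> open [set x | q < F x].
Proof.
by move=> cF; apply: (@open_comp _ _ F [set y | q < y]) => [x _|];
  [exact: cF|exact: open_gt].
Qed.

Lemma open_preimage_gtN (R : realType) (T : topologicalType) (F : T -> R) (q : R) :
  continuous F -> open [set x | q < - F x].
Proof. by move=> cF; apply: open_preimage_gt => x; apply: cvgN; exact: cF. Qed.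

(** * Finiteness of the heavy members of a sunflower *)

Section heavy.
Variables (R : realType) (K : topologicalType) (cK : compact [set: K]).
Local Notation CK := (ctsfun R cK).
Variable phi : CK -> R.
Hypothesis dphi : dual_unit phi.

(* The function [h] is the maximum of functions [f_U] with [q < phi f_U]
   subordinate to the [U] in [s]; the minimum of any [f_U] with the maximum of
   the others is subordinate to the core. *)
Lemma heavy_join (V : set (set K)) (C : set K) (q : R) (s : seq (set K)) :
  sunflower V C -> uniq s ->
  (forall U, U \in s -> V U /\ exists2 f, subord U f & q < phi f) ->
  exists2 h, subord (\bigcup_(U in [set` s]) U) h &
    (q - mass phi C) *+ size s <= phi h.
Proof.
move=> [_ _ _ VC]; elim: s => [_ _|U s IH /= /andP[Us us] sV].
  by exists 0; [exact: subord0|rewrite mulr0n dual_unit0].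
have [W Ws|h sh qh] := IH us; first by apply: sV; rewrite in_cons Ws orbT.
have [VU [f Uf qf]] := sV U (mem_head U s).
exists (ctsfun_max f h).
  move=> x; rewrite ctsfun_maxE.
  have [? ? fU] := Uf x; have [? ? hs] := sh x.
  have [?|?] := leP (f x) (h x); split=> // nUs.
    by apply: hs => -[W Ws Wx]; apply: nUs; exists W => //=; rewrite in_cons Ws orbT.
  by apply: fU => Ux; apply: nUs; exists U => //=; exact: mem_head.
have Ck : subord C (ctsfun_min f h).
  move=> x; rewrite ctsfun_minE.
  have [? ? fU] := Uf x; have [? ? hs] := sh x.
  have minC : ~ C x -> f x = 0 \/ h x = 0.
    move=> nC; have [Ux|] := pselect (U x); last by left; exact: fU.
    right; apply: hs => -[W Ws Wx]; apply: nC; apply: (VC U W) => //.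
      by have [] := sV W; rewrite //= in_cons Ws orbT.
    by move=> UW; rewrite UW Ws in Us.
  by have [?|?] := leP (f x) (h x); split=> // /minC[]; lra.
have -> : ctsfun_max f h = f + h - ctsfun_min f h.
  apply: ctsfunP => x; rewrite ctsfun_subE ctsfun_addE ctsfun_maxE ctsfun_minE.
  by have [|] := leP (f x) (h x) => ?; lra.
have := mass_ub dphi Ck.
by rewrite (dual_unitB dphi) (dual_unitD dphi) mulrS; lra.
Qed.

(** By [heavy_join], [n] such members yield a function on which [phi] is at least [n] times
    [q - mass phi C], yet at most 1. *)
Lemma finite_heavy (V : set (set K)) (C : set K) (q : R) : sunflower V C ->
  mass phi C < q ->
  finite_set [set U | V U /\ exists2 f, subord U f & q < phi f].
Proof.
move=> sf Cq; apply: contrapT => inf.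
have d0 : 0 < q - mass phi C by rewrite subr_gt0.
have [F FV sizeF] := infinite_set_fset (Num.truncn (q - mass phi C)^-1).+1 inf.
have FVq U : U \in F -> V U /\ exists2 f, subord U f & q < phi f by exact: FV.
have [h sh qh] := heavy_join sf (fset_uniq F) FVq.
have := le_trans qh (subord_le1 dphi sh).
apply/negP; rewrite -ltNge -mulr_natr -ltr_pdivrMl// mulr1.
apply: lt_le_trans (truncnS_gt _) _.
by rewrite ler_nat.
Qed.

End heavy.

(** * Gruenhage families on the dual ball *)

Section dual_ball_gruenhage.
Variables (R : realType) (K : topologicalType) (cK : compact [set: K]).
Local Notation CK := (ctsfun R cK).
Local Notation B := (weak_star_ball CK).

Definition signed (b : bool) (phi : CK -> R) : CK -> R :=
  if b then phi else \- phi.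

Lemma ball_dual_unit b (phi : B) : dual_unit (signed b (set_val phi)).
Proof.
have /dual_ballP d := set_valP phi.
by case: b => //; exact: dual_unit_opp.
Qed.

(** Stated with a witness [f] rather than with [mass], so that it is visibly a union of weak* open
    sets; [heavyP] relates the two. *)
Definition heavy (b : bool) (q : R) (U : set K) : set B :=
  [set phi | exists2 f, subord U f & q < signed b (set_val phi) f].

Lemma open_heavy b q U : open (heavy b q U).
Proof.
have -> : heavy b q U = \bigcup_(f in subord U)
    [set phi : B | q < signed b (set_val phi) f].
  by apply/seteqP; split=> phi [f Uf qf]; exists f.
apply: bigcup_open => f _.
have ev : continuous (fun phi : B => (set_val phi : CK -> R) f).
  exact: weak_star_eval_continuous.
by case: b; [exact: open_preimage_gt|exact: open_preimage_gtN].
Qed.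

Lemma heavyP b q U phi : q < mass (signed b (set_val phi)) U <-> heavy b q U phi.
Proof.
have dphi := ball_dual_unit b phi; split=> [qm|[f Uf qf]].
  move: qm; rewrite -subr_gt0 => /(mass_approx dphi U)[f Uf qf].
  by exists f => //; move: qf; rewrite subKr.
exact: lt_le_trans qf (mass_ub dphi Uf).
Qed.

(** A rational [q] between the two masses separates. The core lies in [U], so for the functional of
    smaller mass the core has mass below [q], and [finite_heavy] applies. *)
Lemma heavy_separates (V : set (set K)) (C U : set K) b (phi psi : B) :
  sunflower V C -> V U ->
  mass (signed b (set_val phi)) U != mass (signed b (set_val psi)) U ->
  exists q : rat, exists O, [/\ [set heavy b (ratr q) U | U in V] O,
    exists z, O `&` [set phi; psi] = [set z] &
    finite_set [set O' | [set heavy b (ratr q) U | U in V] O' /\ O' phi] \/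
    finite_set [set O' | [set heavy b (ratr q) U | U in V] O' /\ O' psi]].
Proof.
move=> sf VU; wlog lt_mass : phi psi / mass (signed b (set_val phi)) U <
    mass (signed b (set_val psi)) U.
  move=> hwlog; rewrite neq_lt => /orP[lt|lt].
    by apply: hwlog => //; rewrite lt_eqF.
  have [|q [W [WV Wz fin]]] := hwlog _ _ lt; first by rewrite lt_eqF.
  by exists q, W; split; [|rewrite setUC|case: fin; [right|left]].
move=> _; have [q] := rat_in_itvoo lt_mass; rewrite in_itv /= => /andP[phiq qpsi].
exists q, (heavy b (ratr q) U); split; first by exists U.
  exists psi; apply/seteqP; split=> [x [hx [xphi|//]]|_ ->].
    by move: hx; rewrite xphi => /heavyP; rewrite ltNge ltW.
  by split; [exact/heavyP|right].
left; have CU : C `<=` U by have [_ _ + _] := sf; exact.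
have Cq : mass (signed b (set_val phi)) C < ratr q.
  exact: le_lt_trans (mass_mono (ball_dual_unit b phi) CU) phiq.
have fin := finite_heavy (ball_dual_unit b phi) sf Cq.
apply: sub_finite_set (finite_image (heavy b (ratr q)) fin).
by move=> _ [[W VW <-] hW]; exists W.
Qed.

Lemma gruenhage_weak_star_ball : hausdorff_space K -> gruenhage_space K ->
  gruenhage_space B.
Proof.
move=> hK /gruenhage_sunflower[V [C [sf sep]]].
(* [(s, true)] stands for the petals of the product [s] of sunflowers and
   [(s, false)] for its core, a sunflower with one petal and empty core. *)
pose fam (i : seq (nat * nat) * bool) : set (set K) :=
  if i.2 then petal V C i.1 else [set core C i.1].
have sf_fam i : sunflower (fam i) (if i.2 then core C i.1 else set0).
  rewrite /fam; have sp := sunflower_petal i.1 sf; case: i.2 => //.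
  split=> [_ ->||U _|_ _ -> ->//]; [|exact: open0|exact: sub0set].
  by have [_ + _ _] := sp.
(* The last two components are the sign and the threshold. *)
pose J : countType := (seq (nat * nat) * bool * bool * rat)%type.
apply: (@gruenhage_countType _ J
  (fun j => [set heavy j.1.2 (ratr j.2) U | U in fam j.1.1])).
  by move=> j _ [U _ <-]; exact: open_heavy.
move=> phi psi neq; apply: contrapT => nsep; apply: neq.
have agree i b U : fam i U ->
    mass (signed b (set_val phi)) U = mass (signed b (set_val psi)) U.
  move=> fU; apply: contrapT => /eqP neq; apply: nsep.
  have [q [W WP]] := heavy_separates (sf_fam i) fU neq.
  by exists (i, b, q), W.
apply: val_inj; apply/funext => f.
apply: (dual_unit_unique hK (ball_dual_unit true phi)
  (ball_dual_unit true psi) sf sep).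
  move=> s; rewrite /signed_mass.
  by rewrite (agree (s, false) true)// (agree (s, false) false).
move=> s T pT; rewrite /signed_mass.
by rewrite (agree (s, true) true)// (agree (s, true) false).
Qed.

End dual_ball_gruenhage.

Theorem proposition4p2 (R : realType) (K : topologicalType)
    (cK : compact [set: K]) (hK : hausdorff_space K) (gK : gruenhage_space K) :
  gruenhage_compact (weak_star_ball (ctsfun R cK)).
Proof.
split.
- exact/compact_set_type/compact_dual_ball.
- apply: hausdorff_set_type; apply: hausdorff_product => _; exact: Rhausdorff.
- exact: gruenhage_weak_star_ball.
Qed.
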